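(* Let $G$ and $H$ be finite $\partial$-graphs. If $H$ is layerable and there is an unramified $\partial$-graph morphism $f:G\to H$, then $G$ is also layerable.
   Context: Graphs are undirected multigraphs with vertex set $V$ and set $E$ of oriented edges (each undirected edge gives $e$ and its reverse $\overline{e}$); $e_+$, $e_-$ are the starting and ending vertices of $e$; $\mathcal{E}(x)=\{e: e_+=x\}$. A $\partial$-graph is a graph with a partition $V=V^\circ\sqcup\partial V$ (interior and boundary vertices). A $\partial$-graph morphism $f:G_1\to G_2$ is a map $f:V_1\sqcup E_1\to V_2\sqcup E_2$ such that: (1) $f$ maps vertices to vertices; (2) $f$ maps interior vertices to interior vertices; (3) if $f(e)$ is an oriented edge then $f(e_\pm)=f(e)_\pm$ and $f(\overline{e})=\overline{f(e)}$; (4) if $f(e)$ is a vertex then $f(\overline{e})=f(e)$ and $f(e_\pm)=f(e)$; (5) for every $x\in V_1^\circ$ the restricted map $\mathcal{E}(x)\cap f^{-1}(E_2)\to\mathcal{E}(f(x))$ is $n$-to-$1$ for some integer $n\ge0$ depending on $x$, denoted $\deg(f,x)$. For $x\in\partial V_1$, $\deg(f,x)=\max_{e\in\mathcal{E}(f(x))}|\mathcal{E}(x)\cap f^{-1}(e)|$. The morphism $f$ is unramified if $\deg(f,x)=1$ for $x\in V_1^\circ$ and $\deg(f,x)\le1$ for $x\in\partial V_1$; that is, for all $e\in\mathcal{E}(f(x))$, $|\mathcal{E}(x)\cap f^{-1}(e)|=1$ if $x$ is interior and $\le1$ if $x$ is boundary. Simple layerable extensions: $G'$ is obtained from $G$ by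 (i) adjoining an isolated boundary vertex $x$ if $V(G')=V(G)\sqcup\{x\}$, $E(G')=E(G)$, $V^\circ(G')=V^\circ(G)$, and $x$ is a boundary vertex of $G'$ with no incident edges; (ii) adjoining a boundary spike $e$ if $V(G')=V(G)\sqcup\{e_+\}$, $E(G')=E(G)\sqcup\{e,\overline{e}\}$, $V^\circ(G')=V^\circ(G)\sqcup\{e_-\}$, where in $G'$ the vertex $e_-$ is interior and $e_+$ is a boundary vertex with no other incident edges (so $e_-\in\partial V(G)$); (iii) adjoining a boundary edge $e$ if $V(G')=V(G)$, $V^\circ(G')=V^\circ(G)$, $E(G')=E(G)\sqcup\{e,\overline{e}\}$ and both endpoints of $e$ are boundary vertices. A finite $\partial$-graph is layerable if it is obtained from $\varnothing$ by finitely many such operations. *)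

(* Defs.v *)
From HB Require Import structures.
From mathcomp Require Import all_boot.

Set Implicit Arguments.
Unset Strict Implicit.
Unset Printing Implicit Defensive.

(* Finite undirected multigraphs with boundary.  [edge] is the type of oriented
   edges: every undirected edge, self-loops included, contributes two distinct
   elements [e] and [erev e].  [start e] is e_+; the boundary is the complement
   of [interior]. *)
Record bgraph : Type := BGraph {
  vertex : finType;
  edge : finType;
  start : edge -> vertex;
  erev : edge -> edge;
  erevK : involutive erev;
  erev_neq : forall e, erev e != e;
  interior : {set vertex}
}.

Arguments start {b} e.
Arguments erev {b} e.
Arguments interior b : clear implicits.

Definition finish (G : bgraph) (e : edge G) : vertex G := start (erev e).

Definition boundary (G : bgraph) : {set vertex G} := ~: interior G.

Definition star (G : bgraph) (x : vertex G) : {set edge G} :=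
  [set e | start e == x].

Section Degree.

Variables (G H : bgraph).
Variables (fV : vertex G -> vertex H) (fE : edge G -> vertex H + edge H).

Definition lifts (x : vertex G) (e : edge H) : {set edge G} :=
  [set d in star x | fE d == inr e].

(* The edges at [x] that are not collapsed map [n]-to-1 to those at [fV x].
   If [fV x] is isolated this holds for every [n]. *)
Definition interior_degree (x : vertex G) (n : nat) : Prop :=
  forall e, e \in star (fV x) -> #|lifts x e| = n.

Definition boundary_degree (x : vertex G) : nat :=
  \max_(e in star (fV x)) #|lifts x e|.

End Degree.

(* A map V(G) + E(G) -> V(H) + E(H) sending vertices to vertices is given by its
   restrictions to vertices and to edges; an edge sent to [inl w] is collapsed
   to the vertex [w]. *)
Record bmorphism (G H : bgraph) : Type := BMorphism {
  mor_vertex : vertex G -> vertex H;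
  mor_edge : edge G -> vertex H + edge H;
  mor_interior : forall x, x \in interior G -> mor_vertex x \in interior H;
  mor_edge_edge : forall d e, mor_edge d = inr e ->
    [/\ mor_vertex (start d) = start e,
        mor_vertex (finish d) = finish e &
        mor_edge (erev d) = inr (erev e)];
  mor_edge_vertex : forall d w, mor_edge d = inl w ->
    [/\ mor_edge (erev d) = inl w,
        mor_vertex (start d) = w &
        mor_vertex (finish d) = w];
  mor_degree : forall x, x \in interior G ->
    exists n, interior_degree mor_vertex mor_edge x n
}.

Definition unramified (G H : bgraph) (f : bmorphism G H) : Prop :=
  (forall x, x \in interior G ->
     interior_degree (mor_vertex f) (mor_edge f) x 1) /\
  (forall x, x \in boundary G ->
     boundary_degree (mor_vertex f) (mor_edge f) x <= 1).

(* [G] as a subgraph of [G'], with no condition on the interior vertices: this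
   stands for the inclusions V(G) <= V(G') and E(G) <= E(G'), so that the
   notions below are invariant under isomorphism. *)
Record inclusion (G G' : bgraph) : Type := Inclusion {
  inc_vertex : vertex G -> vertex G';
  inc_edge : edge G -> edge G';
  inc_vertex_inj : injective inc_vertex;
  inc_edge_inj : injective inc_edge;
  inc_start : forall e, inc_vertex (start e) = start (inc_edge e);
  inc_erev : forall e, inc_edge (erev e) = erev (inc_edge e)
}.

Section Extensions.

Variables (G G' : bgraph) (i : inclusion G G').

Local Notation VG := (inc_vertex i @: [set: vertex G]).
Local Notation EG := (inc_edge i @: [set: edge G]).
Local Notation IG := (inc_vertex i @: interior G).

Definition adjoins_isolated_vertex (x : vertex G') : Prop :=
  [/\ VG = [set~ x],
      EG = [set: edge G'],
      interior G' = IG,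
      x \in boundary G' &
      star x = set0].

Definition adjoins_boundary_spike (e : edge G') : Prop :=
  [/\ VG = [set~ start e],
      EG = ~: [set e; erev e],
      finish e \notin IG /\ interior G' = finish e |: IG,
      start e \in boundary G' &
      star (start e) = [set e]].

Definition adjoins_boundary_edge (e : edge G') : Prop :=
  [/\ VG = [set: vertex G'],
      EG = ~: [set e; erev e],
      interior G' = IG,
      start e \in boundary G' &
      finish e \in boundary G'].

End Extensions.

Definition simple_layerable_extension (G G' : bgraph) : Prop :=
  exists i : inclusion G G',
    [\/ exists x, adjoins_isolated_vertex i x,
        exists e, adjoins_boundary_spike i e |
        exists e, adjoins_boundary_edge i e].

Inductive layerable : bgraph -> Prop :=
| layerable_empty G : #|vertex G| = 0 -> layerable G
| layerable_step G G' :
    layerable G -> simple_layerable_extension G G' -> layerable G'.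

(* Main.v *)
Require Import Defs.
From mathcomp Require Import all_boot.

(** The idea is to take apart [G] and [H] together.  Call a graph reducible if
    it is a simple layerable extension of another one, which then has fewer
    vertices and edges in total.  If [G] extends [G0], an unramified morphism
    from [G] to [H] restricts to one from [G0] to [H] ([covering_restrict]):
    the interior vertices of [G0] keep all their edges, and a vertex that
    changes from interior to boundary only has a weaker condition to satisfy.

    The proof is by induction on the construction of [H], then on the size
    of [G].  Let [H] be a simple extension of [H0].  If [G] is reducible, remove
    a piece of it and use the inner induction.  Otherwise the morphism factors
    through [H0] ([reducible_or_covers]) and the outer induction applies.  For
    if [G] is not reducible:
    - No vertex [y] lies over a boundary vertex [v] with at most one edge.
      Such a [y] is a boundary vertex; a collapsed edge at [y] would be a
      boundary edge, and if there is none then the star of [y] embeds in that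
      of [v], so that [y] is isolated, or the end of a spike or of a boundary
      edge ([reducible_over_leaf]).
    - No edge lies over an edge that joins two boundary vertices, as it would
      itself be a boundary edge.
    - If [H] is [H0] with a spike from [p], now interior, to [v], then no vertex
      lies over [v], hence no edge lies over the spike; an interior vertex over
      [p] would have such an edge, so every vertex over [p] is a boundary
      vertex. *)

Set Implicit Arguments.
Unset Strict Implicit.
Unset Printing Implicit Defensive.

Lemma mem_star (G : bgraph) (x : vertex G) (e : edge G) :
  (e \in star x) = (start e == x).
Proof. by rewrite inE. Qed.

(** * Unramified morphisms as local conditions on maps *)

(** The maps [fV], [fE] form an unramified morphism, with the degrees spelled
    out: the edges at a vertex that are not collapsed map injectively, and at
    an interior vertex they map onto the star of the image. *)
Record covering (G H : bgraph) (fV : vertex G -> vertex H)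
    (fE : edge G -> vertex H + edge H) : Prop := Covering {
  cov_interior : forall x, x \in interior G -> fV x \in interior H;
  cov_edge : forall d e, fE d = inr e ->
    [/\ fV (start d) = start e,
        fV (finish d) = finish e &
        fE (erev d) = inr (erev e)];
  cov_collapsed : forall d w, fE d = inl w ->
    [/\ fE (erev d) = inl w, fV (start d) = w & fV (finish d) = w];
  cov_inj : forall d d' e, start d = start d' ->
    fE d = inr e -> fE d' = inr e -> d = d';
  cov_surj : forall x e, x \in interior G -> start e = fV x ->
    exists2 d, start d = x & fE d = inr e
}.

(** There is an unramified morphism from [G] to [H]. *)
Definition covers (G H : bgraph) : Prop :=
  exists (fV : vertex G -> vertex H) (fE : edge G -> vertex H + edge H),
    covering fV fE.

Lemma unramified_covering (G H : bgraph) (f : bmorphism G H) :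
  unramified f -> covering (mor_vertex f) (mor_edge f).
Proof.
case=> deg_int deg_bd; split.
- exact: mor_interior.
- exact: mor_edge_edge.
- exact: mor_edge_vertex.
- move=> d d' e sdd' fd fd'.
  have se : e \in star (mor_vertex f (start d)).
    by rewrite mem_star; have [-> _ _] := mor_edge_edge fd.
  have le1 : #|lifts (mor_edge f) (start d) e| <= 1.
    have [xi | xb] := boolP (start d \in interior G).
      by rewrite (deg_int _ xi).
    apply: leq_trans (deg_bd (start d) _); last by rewrite inE.
    by rewrite /boundary_degree (bigD1 e) //= leq_maxl.
  have dl : d \in lifts (mor_edge f) (start d) e.
    by rewrite inE mem_star fd !eqxx.
  have dl' : d' \in lifts (mor_edge f) (start d) e.
    by rewrite inE mem_star sdd' fd' !eqxx.
  exact: (card_le1_eqP le1).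
- move=> x e xi se.
  have e_star : e \in star (mor_vertex f x) by rewrite mem_star se.
  have /eqP/cards1P [d def_d] := deg_int x xi e e_star.
  have : d \in lifts (mor_edge f) x e by rewrite def_d set11.
  by rewrite inE mem_star => /andP[/eqP sd /eqP fd]; exists d.
Qed.

Lemma covering_boundary (G H : bgraph) (fV : vertex G -> vertex H)
    (fE : edge G -> vertex H + edge H) (x : vertex G) :
  covering fV fE -> fV x \in boundary H -> x \in boundary G.
Proof. by move=> cov; rewrite !inE; apply: contra; apply: (cov_interior cov). Qed.

(** A covering of [H] factors through a subgraph [H0] as soon as its values lie
    in [H0] and its interior vertices lie over the interior of [H0]; it does
    not matter how the stars of [H0] sit in those of [H]. *)
Lemma covering_factor (G H0 H : bgraph) (i : inclusion H0 H)
    (fV : vertex G -> vertex H) (fE : edge G -> vertex H + edge H) :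
  covering fV fE ->
  (forall x, fV x \in inc_vertex i @: [set: vertex H0]) ->
  (forall d e, fE d = inr e -> e \in inc_edge i @: [set: edge H0]) ->
  (forall x, x \in interior G -> fV x \in inc_vertex i @: interior H0) ->
  covers G H0.
Proof.
move=> cov imV imE imI.
have preimV x : exists v, inc_vertex i v = fV x.
  by have /imsetP[v _ ->] := imV x; exists v.
have [gV gVP] := fin_all_exists preimV.
pose incl s := match s with
  | inl v => inl (inc_vertex i v)
  | inr e => inr (inc_edge i e)
  end.
have preimE d : exists s, incl s = fE d.
  case def_fd: (fE d) => [w | e].
    exists (inl (gV (start d))); rewrite /= gVP.
    by have [_ -> _] := cov_collapsed cov def_fd.
  by have /imsetP[e0 _ ->] := imE d e def_fd; exists (inr e0).
have [gE gEP] := fin_all_exists preimE.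
have incl_inj : injective incl.
  by move=> [v|e] [v'|e'] //= [] => [/inc_vertex_inj | /inc_edge_inj] ->.
have iVI := @inc_vertex_inj _ _ i.
exists gV, gE; split.
- move=> x /imI /imsetP[v vi]; rewrite -gVP => /iVI -> //.
- move=> d e gd.
  have fd : fE d = inr (inc_edge i e) by rewrite -gEP gd.
  have [sd td rd] := cov_edge cov fd; split.
  + by apply: iVI; rewrite gVP sd inc_start.
  + by apply: iVI; rewrite gVP td /finish inc_start inc_erev.
  + by apply: incl_inj; rewrite gEP rd /= inc_erev.
- move=> d w gd.
  have fd : fE d = inl (inc_vertex i w) by rewrite -gEP gd.
  have [rd sd td] := cov_collapsed cov fd; split.
  + by apply: incl_inj; rewrite gEP rd.
  + by apply: iVI; rewrite gVP sd.
  + by apply: iVI; rewrite gVP td.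
- move=> d d' e sdd' gd gd'.
  by apply: (cov_inj cov (e := inc_edge i e) sdd'); rewrite -gEP ?gd ?gd'.
- move=> x e xi se.
  have [|d sd fd] := cov_surj cov (x := x) (e := inc_edge i e) xi.
    by rewrite -inc_start se gVP.
  by exists d => //; apply: incl_inj; rewrite gEP fd.
Qed.

(** * Reducible graphs *)

(** [G] is obtained from some graph by one simple layerable operation. *)
Definition reducible (G : bgraph) : Prop :=
  exists G0, simple_layerable_extension G0 G.

(** The number of vertices plus the number of oriented edges. *)
Definition size_bgraph (G : bgraph) : nat := #|vertex G| + #|edge G|.

Lemma extension_size (G0 G : bgraph) :
  simple_layerable_extension G0 G -> size_bgraph G0 < size_bgraph G.
Proof.
case=> i ext; rewrite /size_bgraph.
have cV : #|inc_vertex i @: [set: vertex G0]| = #|vertex G0|.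
  by rewrite card_imset ?cardsT //; apply: inc_vertex_inj.
have cE : #|inc_edge i @: [set: edge G0]| = #|edge G0|.
  by rewrite card_imset ?cardsT //; apply: inc_edge_inj.
have ltV x : inc_vertex i @: [set: vertex G0] = [set~ x] ->
    #|vertex G0| < #|vertex G|.
  by move=> VG; rewrite -cV VG -(cardsC [set x]) cards1.
have leV : #|vertex G0| <= #|vertex G| by rewrite -cV max_card.
have leE : #|edge G0| <= #|edge G| by rewrite -cE max_card.
case: ext => [[x [/ltV V_lt _ _ _ _]] | [e [/ltV V_lt _ _ _ _]]
             | [e [_ E_del _ _ _]]].
- by rewrite -addSn leq_add.
- by rewrite -addSn leq_add.
rewrite -addnS leq_add // -cE E_del -cardsT.
apply/proper_card/properP; split; first exact: subsetT.
by exists e; rewrite !inE ?eqxx.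
Qed.

(** In a simple extension, the vertices that were already interior stay so and
    receive no new edges. *)
Lemma extension_interior (G0 G : bgraph) (i : inclusion G0 G) (x : vertex G0) :
  [\/ exists x, adjoins_isolated_vertex i x,
      exists e, adjoins_boundary_spike i e |
      exists e, adjoins_boundary_edge i e] ->
  x \in interior G0 ->
  inc_vertex i x \in interior G /\
  (forall d, start d = inc_vertex i x -> d \in inc_edge i @: [set: edge G0]).
Proof.
move=> ext xi; have im_x := imset_f (inc_vertex i) xi.
case: ext => [[y [_ -> -> _ _]] | [e [_ -> [te int_G] se _]]
             | [e [_ -> int_G se te]]].
- by split=> // d _; rewrite inE.
- have x_int : inc_vertex i x \in finish e |: inc_vertex i @: interior G0.
    by rewrite in_setU1 im_x orbT.
  split; first by rewrite int_G.
  move=> d sd; rewrite !inE; apply/negP => /orP[] /eqP def_d.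
    by move: se; rewrite -def_d sd inE int_G x_int.
  by move: te; rewrite /finish -def_d sd im_x.
- rewrite int_G; split=> // d sd; rewrite !inE; apply/negP => /orP[] /eqP def_d.
    by move: se; rewrite -def_d sd inE int_G im_x.
  by move: te; rewrite /finish -def_d sd inE int_G im_x.
Qed.

Lemma covering_restrict (G0 G H : bgraph) :
  simple_layerable_extension G0 G -> covers G H -> covers G0 H.
Proof.
case=> i /extension_interior ext [fV [fE cov]].
exists (fV \o inc_vertex i), (fE \o inc_edge i); split=> /=.
- by move=> x /ext[xi _]; apply: (cov_interior cov).
- move=> d e fd; have [sd td rd] := cov_edge cov fd.
  by rewrite /finish !inc_start inc_erev.
- move=> d w fd; have [rd sd td] := cov_collapsed cov fd.
  by rewrite /finish !inc_start inc_erev.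
- move=> d d' e sdd' fd fd'; apply: (@inc_edge_inj _ _ i).
  by apply: (cov_inj cov (e := e)); rewrite -?inc_start ?sdd'.
- move=> x e /ext[xi star_x] se.
  have [d sd fd] := cov_surj cov xi se.
  have /imsetP[d0 _ def_d] := star_x d sd.
  exists d0; last by rewrite -def_d.
  by apply: (@inc_vertex_inj _ _ i); rewrite inc_start -def_d.
Qed.

(** The subgraph of [G] with vertices [A], edges [B] and interior [A :&: I].
    The set [I] need not consist of interior vertices of [G], nor contain all
    those in [A]. *)
Definition subgraph (G : bgraph) (A : {set vertex G}) (B : {set edge G})
    (I : {set vertex G}) (B_rev : forall e, e \in B -> erev e \in B)
    (B_start : forall e, e \in B -> start e \in A) : bgraph :=
  let rev (e : {e | e \in B}) : {e | e \in B} :=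
    exist _ (erev (val e)) (B_rev (val e) (valP e)) in
  @BGraph {x | x \in A} {e | e \in B}
    (fun e => exist _ (start (val e)) (B_start (val e) (valP e)))
    rev
    (fun e => val_inj (erevK (val e) : val (rev (rev e)) = val e))
    (fun e => erev_neq (val e))
    (val @^-1: I).

Definition subgraph_inclusion (G : bgraph) (A : {set vertex G})
    (B : {set edge G}) (I : {set vertex G})
    (B_rev : forall e, e \in B -> erev e \in B)
    (B_start : forall e, e \in B -> start e \in A) :
    inclusion (subgraph I B_rev B_start) G :=
  @Inclusion (subgraph I B_rev B_start) G val val val_inj val_inj
    (fun=> erefl) (fun=> erefl).

Lemma imset_val_preim (T : finType) (A I : {set T}) :
  val @: (val @^-1: I : {set {x | x \in A}}) = A :&: I.
Proof.
apply/setP=> x; rewrite inE; apply/imsetP/andP => [[u ui ->] | [xA xI]].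
  by split; [apply: valP | rewrite inE in ui].
by exists (exist _ x xA); rewrite ?inE.
Qed.

Lemma imset_val (T : finType) (A : {set T}) :
  val @: [set: {x | x \in A}] = A.
Proof. by rewrite -(preimsetT val) imset_val_preim setIT. Qed.

Lemma erev_setC2 (G : bgraph) (e d : edge G) :
  d \in ~: [set e; erev e] -> erev d \in ~: [set e; erev e].
Proof.
rewrite !inE (inj_eq (can_inj (@erevK G))) orbC; apply: contra.
by rewrite (can2_eq (@erevK G) (@erevK G)).
Qed.

Lemma reducible_isolated (G : bgraph) (x : vertex G) :
  x \in boundary G -> star x = set0 -> reducible G.
Proof.
move=> xb star_x.
have B_start (e : edge G) : e \in [set: edge G] -> start e \in [set~ x].
  by move=> _; rewrite !inE -mem_star star_x inE.
have B_rev (e : edge G) : e \in [set: edge G] -> erev e \in [set: edge G].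
  by rewrite inE.
exists (subgraph (interior G) B_rev B_start), (subgraph_inclusion _ _ _).
apply: Or31; exists x; split=> //=; rewrite ?imset_val // imset_val_preim.
apply/esym/setIidPr/subsetP => y yi; rewrite !inE.
by apply: contraTneq yi => ->; rewrite inE in xb.
Qed.

Lemma reducible_boundary_edge (G : bgraph) (e : edge G) :
  start e \in boundary G -> finish e \in boundary G -> reducible G.
Proof.
move=> se te.
have B_start (d : edge G) : d \in ~: [set e; erev e] -> start d \in setT.
  by rewrite inE.
exists (subgraph (interior G) (@erev_setC2 G e) B_start).
exists (subgraph_inclusion _ _ _).
by apply: Or33; exists e; split; rewrite //= ?imset_val ?imset_val_preim ?setTI.
Qed.

Lemma reducible_spike (G : bgraph) (e : edge G) :
  start e \in boundary G -> finish e \in interior G ->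
  star (start e) = [set e] -> reducible G.
Proof.
move=> se te star_e.
have B_start d : d \in ~: [set e; erev e] -> start d \in [set~ start e].
  rewrite !inE; apply: contraNneq => sd.
  by rewrite -in_set1 -star_e mem_star sd eqxx.
exists (subgraph (interior G :\ finish e) (@erev_setC2 G e) B_start).
exists (subgraph_inclusion _ _ _).
have int_G0 : [set~ start e] :&: (interior G :\ finish e)
    = interior G :\ finish e.
  apply/setIidPr/subsetP => y /setD1P[_ yi]; rewrite !inE.
  by apply: contraTneq yi => ->; rewrite inE in se.
apply: Or32; exists e; split; rewrite //= ?imset_val ?imset_val_preim //.
by rewrite int_G0 setD1K // !inE eqxx.
Qed.

(** A boundary vertex with one edge is the end of a boundary edge or of a spike,
    according to whether the other endpoint is a boundary vertex. *)
Lemma reducible_boundary_leaf (G : bgraph) (x : vertex G) :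
  x \in boundary G -> #|star x| <= 1 -> reducible G.
Proof.
move=> xb; rewrite leq_eqVlt ltnS leqn0 cards_eq0 => /orP[/cards1P[e star_x]|].
  have /eqP def_x : start e == x by rewrite -mem_star star_x set11.
  have [te | te] := boolP (finish e \in interior G).
    by apply: (@reducible_spike G e); rewrite ?def_x.
  by apply: (@reducible_boundary_edge G e); rewrite ?def_x // inE.
by move/eqP; apply: reducible_isolated.
Qed.

(** * Irreducible graphs over a simple extension *)

(** A vertex over a boundary vertex with at most one edge is a boundary vertex.
    Either it is the end of a collapsed edge, which joins two boundary vertices,
    or it has itself at most one edge. *)
Lemma reducible_over_leaf (G H : bgraph) (fV : vertex G -> vertex H)
    (fE : edge G -> vertex H + edge H) (y : vertex G) :
  covering fV fE -> fV y \in boundary H -> #|star (fV y)| <= 1 -> reducible G.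
Proof.
move=> cov vb star_v; have yb := covering_boundary cov vb.
have [/existsP[d /andP[/eqP sd /eqP fd]] | no_collapse] :=
  boolP [exists d, (start d == y) && (fE d == inl (fV y))].
  have [_ _ td] := cov_collapsed cov fd.
  apply: (@reducible_boundary_edge G d); first by rewrite sd.
  by apply: (covering_boundary cov); rewrite td.
have edge_at_y d : d \in star y -> exists2 e, fE d = inr e & start e = fV y.
  rewrite mem_star => /eqP sd; case fd: (fE d) => [w | e].
    have [_ sw _] := cov_collapsed cov fd.
    case/existsP: no_collapse; exists d.
    by rewrite sd fd -sw sd !eqxx.
  by exists e => //; have [<- _ _] := cov_edge cov fd; rewrite sd.
apply: (reducible_boundary_leaf yb); apply/card_le1_eqP => d d' dy dy'.
have [e fd se] := edge_at_y d dy; have [e' fd' se'] := edge_at_y d' dy'.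
have ee' : e' = e.
  by apply: (card_le1_eqP star_v); rewrite mem_star ?se ?se'.
move: dy dy'; rewrite !mem_star => /eqP sd /eqP sd'.
by apply: (cov_inj cov (e := e)); rewrite ?sd ?sd' // fd' ee'.
Qed.

(** In each of the three cases [G] is reducible as soon as something lies over
    the part of [H] outside [H0]. *)
Lemma reducible_or_covers (G H0 H : bgraph) :
  simple_layerable_extension H0 H -> covers G H -> reducible G \/ covers G H0.
Proof.
case=> i ext [fV [fE cov]].
case: ext => [[v [VH EH IH vb star_v]] | [e [VH EH [_ IH] vb star_v]]
             | [e [VH EH IH sb tb]]].
- have [/existsP[y /eqP fy] | no_y] := boolP [exists y, fV y == v].
    by left; apply: (reducible_over_leaf (y := y) cov);
      rewrite fy // star_v cards0.
  right; apply: (covering_factor (i := i) cov) => [x | d e _ | x xi].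
  + by rewrite VH !inE; apply: contra no_y => fx; apply/existsP; exists x.
  + by rewrite EH inE.
  + by rewrite -IH (cov_interior cov).
- have [/existsP[y /eqP fy] | no_y] := boolP [exists y, fV y == start e].
    by left; apply: (reducible_over_leaf (y := y) cov);
      rewrite fy // star_v cards1.
  have not_over x : fV x != start e.
    by apply: contra no_y => fx; apply/existsP; exists x.
  have no_lift d : (fE d != inr e) && (fE d != inr (erev e)).
    apply/andP; split; apply/eqP => /(cov_edge cov)[sd td _].
      by have := not_over (start d); rewrite sd eqxx.
    by have := not_over (finish d); rewrite td /finish erevK eqxx.
  right; apply: (covering_factor (i := i) cov) => [x | d e' fd | x xi].
  + by rewrite VH !inE.
  + by have := no_lift d; rewrite EH !inE fd negb_or.
  (* An interior vertex over the base of the spike would lift the spike. *)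
  + have := cov_interior cov xi; rewrite IH => /setU1P[fx | //].
    have [d _ fd] := cov_surj cov (e := erev e) xi (esym fx).
    by have := no_lift d; rewrite fd eqxx andbF.
- have [/existsP[d fd] | no_d] :=
    boolP [exists d, (fE d == inr e) || (fE d == inr (erev e))].
    left; apply: (@reducible_boundary_edge G d); apply: (covering_boundary cov).
      by case/orP: fd => /eqP /(cov_edge cov)[-> _ _].
    by case/orP: fd => /eqP /(cov_edge cov)[_ -> _]; rewrite // /finish erevK.
  right; apply: (covering_factor (i := i) cov) => [x | d e' fd | x xi].
  + by rewrite VH inE.
  + rewrite EH !inE; apply: contra no_d => def_e'; apply/existsP; exists d.
    by rewrite fd.
  + by rewrite -IH (cov_interior cov).
Qed.

Lemma layerable_covers (G H : bgraph) :
  layerable H -> covers G H -> layerable G.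
Proof.
move=> lay; elim: lay G => [{}H H_empty | H0 {}H _ IHH ext] G.
  case=> fV _; apply: layerable_empty; apply: eq_card0 => x.
  by have := card0_eq H_empty (fV x).
have [n] := ubnP (size_bgraph G); elim: n G => // n IHn G size_G cov.
have [[G0 red] | /IHH //] := reducible_or_covers ext cov.
apply: (layerable_step _ red); apply: IHn (covering_restrict red cov).
exact: leq_trans (extension_size red) _.
Qed.

Theorem lemma6p4 (G H : bgraph) :
  layerable H -> (exists f : bmorphism G H, unramified f) -> layerable G.
Proof.
move=> lay [f unram]; apply: (layerable_covers lay).
by exists (mor_vertex f), (mor_edge f); apply: unramified_covering.
Qed.
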